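(* There exist $2^{\aleph_0}$ path-minimal graphs whose ages are pairwise incomparable with respect to set inclusion and each of which is well-quasi-ordered under embeddability.
   Context: Graphs are undirected, simple and loopless. A graph $H$ embeds in a graph $H'$ if $H$ is isomorphic to an induced subgraph of $H'$. The age $\mathcal{A}(G)$ of a graph $G$ is the collection of finite graphs (up to isomorphism) that embed in $G$, ordered by embeddability; it is well-quasi-ordered (wqo) if it contains no infinite antichain (and no infinite strictly descending chain, which is automatic for finite graphs). A path is a graph $P$ for which there is an injective map $f$ from $V(P)$ into an interval of $\mathbb{Z}$ such that $\{u,v\}\in E(P)$ iff $|f(u)-f(v)|=1$; the length of a finite path is its number of vertices minus one. A graph contains finite induced paths of unbounded length if for every $n$ it has an induced subgraph which is a finite path of length at least $n$. A graph $G$ is path-minimal if it contains finite induced paths of unbounded length and every induced subgraph $G'$ of $G$ with this property embeds $G$. *)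

(* Defs.v *)
From mathcomp Require Import all_boot all_order all_algebra.
From mathcomp Require Import all_classical.

Set Implicit Arguments.
Unset Strict Implicit.
Unset Printing Implicit Defensive.

Local Open Scope classical_set_scope.
Local Open Scope card_scope.
Local Open Scope ring_scope.

Record graph := Graph {
  vertex :> Type;
  adj : vertex -> vertex -> Prop;
  adj_sym : forall x y, adj x y -> adj y x;
  adj_irr : forall x, ~ adj x x }.

Section Induced.
Variables (G : graph) (A : set G).

(* Not the coercion of A to set_type: its universe is too large for graph to be
   the carrier of a set, as needed for age. *)
Definition induced_adj (x y : {x : G | A x}) := adj (sval x) (sval y).

Lemma induced_adj_sym x y : induced_adj x y -> induced_adj y x.
Proof. exact: adj_sym. Qed.

Lemma induced_adj_irr x : ~ induced_adj x x.
Proof. exact: adj_irr. Qed.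

Definition induced : graph := Graph induced_adj_sym induced_adj_irr.

End Induced.

Definition isomorphic (H K : graph) :=
  exists f : H -> K, bijective f /\ forall x y, adj x y <-> adj (f x) (f y).

Definition embeds (H K : graph) := exists A : set K, isomorphic H (induced A).

(* Graphs are not quotiented by isomorphism: ages are isomorphism-closed, so
   inclusion between them is inclusion between sets of isomorphism types. *)
Definition age (G : graph) : set graph :=
  [set H : graph | finite_set [set: H] /\ embeds H G].

(* Vertices are enumerated by a whole interval of the integers, so that paths
   are connected. *)
Definition is_path (P : graph) :=
  exists (I : interval int) (f : P -> int),
    set_bij [set: P] [set` I] f /\
    forall u v, adj u v <-> `|f u - f v| = 1.

Definition finite_path (n : nat) (P : graph) :=
  is_path P /\ [set: P] #= `I_n.+1.

Definition unbounded_paths (G : graph) :=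
  forall n, exists (m : nat) (A : set G),
    (n <= m)%N /\ finite_path m (induced A).

Definition path_minimal (G : graph) :=
  unbounded_paths G /\
  forall A : set G, unbounded_paths (induced A) -> embeds G (induced A).

Definition antichain (T : Type) (le : T -> T -> Prop) (B : set T) :=
  forall x y, B x -> B y -> x <> y -> ~ le x y.

(* Here le is a quasi-order; an antichain of its quotient poset is the image of
   a set B with antichain le B, since equivalent elements are comparable. *)
Definition wqo (T : Type) (le : T -> T -> Prop) (A : set T) :=
  (forall B : set T, B `<=` A -> antichain le B -> finite_set B) /\
  ~ exists u : nat -> T,
      (forall n, A (u n)) /\
      (forall n, le (u n.+1) (u n) /\ ~ le (u n) (u n.+1)).

(* Main.v *)
(** For y : nat -> bool, let w(n) = y(v_3(n)), where v_3 is the 3-adic valuation.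
This Toeplitz word is uniformly recurrent, as w(3^K c + n) = w(n) whenever
0 < n < 3^K. Let G_y be the disjoint union of finite paths, the i-th one
labelled by w(1), ..., w(i), with all edges added between vertices labelled 1 of
distinct paths.

- Nonadjacent label-1 vertices of an induced path lie in the same component. As
  0-runs of w are bounded, it follows that a long induced path is an interval of
  a single component. By uniform recurrence
  an induced subgraph with unbounded paths then contains, in infinitely many
  components, labelled copies of every component: G_y is path-minimal.
- A finite induced subgraph of G_y is a sequence of sequences of factors of w.
  By uniform recurrence a factor occurs in every long enough one, so factors are
  wqo, and applying Higman's lemma twice shows that the age is wqo.
- In two copies of a long path the cross edges reveal the labels, so an inclusion
  of ages forces the factors of one word to occur, up to reversal, in the other.
  For suitable y these factors determine y. *)

Require Import Defs.
From mathcomp Require Import all_boot all_order all_algebra.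
From mathcomp Require Import all_classical.
From mathcomp Require Import zify.

Set Implicit Arguments.
Unset Strict Implicit.
Unset Printing Implicit Defensive.

Local Open Scope classical_set_scope.
Local Open Scope card_scope.

(** * Higman's lemma *)

Definition good (T : Type) (R : T -> T -> Prop) (A : T -> Prop) :=
  forall u : nat -> T, (forall n, A (u n)) ->
    exists i j, (i < j)%N /\ R (u i) (u j).

(** Indices with no later term above theirs are bounded, since infinitely many of them would form a
    bad sequence. Beyond them a later term above can be picked forever. *)
Lemma good_subsequence (T : Type) (R : T -> T -> Prop) (A : T -> Prop)
    (u : nat -> T) :
  (forall x y z, R x y -> R y z -> R x z) -> good R A ->
  (forall n, A (u n)) ->
  exists phi : nat -> nat, (forall i j, i < j -> phi i < phi j)%N /\
    forall i j, (i < j)%N -> R (u (phi i)) (u (phi j)).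
Proof.
move=> Rtr gR Au.
have [N HN] : exists N, forall n, (N <= n)%N ->
    exists m, (n < m)%N /\ R (u n) (u m).
  apply: contrapT => noN.
  have term N : exists n, (N <= n)%N /\ forall m, (n < m)%N -> ~ R (u n) (u m).
    apply: contrapT => noterm; apply: noN; exists N => n Nn.
    apply: contrapT => nom; apply: noterm; exists n; split=> // m nm Rnm.
    by apply: nom; exists m.
  have [t Ht] := choice term.
  pose psi := fix psi n := if n is n'.+1 then t (psi n').+1 else t 0%N.
  have psiS n : (psi n < psi n.+1)%N by exact: (Ht _).1.
  have psi_lt i j : (i < j)%N -> (psi i < psi j)%N.
    by apply: (homo_ltn ltn_trans).
  have [i [j [ij Rij]]] := gR (u \o psi) (fun n => Au _).
  case: i ij Rij => [|i] ij Rij; first exact: (Ht _).2 (psi_lt _ _ ij) Rij.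
  exact: (Ht _).2 (psi_lt _ _ ij) Rij.
have [f Hf] : exists f : nat -> nat, forall n, (N <= n)%N ->
    (n < f n)%N /\ R (u n) (u (f n)).
  have tot n : exists m, (N <= n)%N -> (n < m)%N /\ R (u n) (u m).
    case: (leqP N n) => [/HN[m Hm]|_]; first by exists m.
    by exists 0%N.
  by have [f Hf] := choice tot; exists f.
pose phi n := iter n f N.
have phiN n : (N <= phi n)%N.
  elim: n => //= n IH; exact: leq_trans IH (ltnW (Hf _ IH).1).
exists phi; split.
  apply: (homo_ltn ltn_trans) => n; exact: (Hf _ (phiN n)).1.
apply: (homo_ltn (r := fun i j => R (u i) (u j))) => [y x z|n]; first exact: Rtr.
exact: (Hf _ (phiN n)).2.
Qed.

Inductive seq_emb (T : Type) (R : T -> T -> Prop) : seq T -> seq T -> Prop :=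
| seq_emb_nil t : seq_emb R [::] t
| seq_emb_cons x y s t : R x y -> seq_emb R s t -> seq_emb R (x :: s) (y :: t)
| seq_emb_skip y s t : seq_emb R s t -> seq_emb R s (y :: t).

Lemma seq_emb_trans (T : Type) (R : T -> T -> Prop) :
  (forall x y z, R x y -> R y z -> R x z) ->
  forall r s t, seq_emb R r s -> seq_emb R s t -> seq_emb R r t.
Proof.
move=> Rtr r s t rs st; elim: st r rs => {s t}.
- by move=> t r rs; inversion rs; constructor.
- move=> x y s t Rxy st IH r rs; inversion rs; subst.
  + by constructor.
  + by apply: seq_emb_cons; [exact: Rtr Rxy|exact: IH].
  + by apply: seq_emb_skip; exact: IH.
- by move=> y s t st IH r /IH; exact: seq_emb_skip.
Qed.

(** The index map increases on all of [nat], not only below [size s], so it is injective with no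
    bounds to check. *)
Lemma seq_emb_index (T : Type) (R : T -> T -> Prop) (x0 : T) (s t : seq T) :
  seq_emb R s t ->
  exists f : nat -> nat, (forall i j, i < j -> f i < f j)%N /\
    forall i, (i < size s)%N -> (f i < size t)%N /\ R (nth x0 s i) (nth x0 t (f i)).
Proof.
elim=> {s t}.
- by move=> t; exists id.
- move=> x y s t Rxy st [f [fm fR]].
  exists (fun i => if i is i'.+1 then (f i').+1 else 0%N); split.
    by case=> [|i] [|j] //=; rewrite !ltnS; exact: fm.
  by case=> [|i] //=; rewrite !ltnS; exact: fR.
- move=> y s t st [f [fm fR]]; exists (fun i => (f i).+1); split=> //.
Qed.

(* Nash-Williams' minimal bad sequence argument. *)
Lemma higman (T : eqType) (R : T -> T -> Prop) (A : T -> Prop) :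
  (forall x y z, R x y -> R y z -> R x z) -> good R A ->
  good (seq_emb R) (fun s => forall x, x \in s -> A x).
Proof.
move=> Rtr gR u Au; apply: contrapT => u_bad.
pose bad (v : nat -> seq T) := (forall n x, x \in v n -> A x) /\
  forall i j, (i < j)%N -> ~ seq_emb R (v i) (v j).
have bad_u : bad u.
  by split=> // i j ij e; apply: u_bad; exists i, j.
pose agree n (v v' : nat -> seq T) := forall i, (i < n)%N -> v' i = v i.
(* Among the bad sequences agreeing with [nv.2] before [nv.1], one whose term at [nv.1] is shortest.
   Iterating fixes one more term at each stage, and the diagonal [d] is the minimal bad sequence. *)
have minstep (nv : nat * (nat -> seq T)) : exists v', bad nv.2 ->
    [/\ bad v', agree nv.1 nv.2 v' & forall v'', bad v'' -> agree nv.1 nv.2 v'' ->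
       (size (v' nv.1) <= size (v'' nv.1))%N].
  case: nv => n v /=.
  have [bv|nb] := pselect (bad v); last by exists v.
  pose P k := `[< exists v', [/\ bad v', agree n v v' & size (v' n) = k] >].
  have exP : exists k, P k by exists (size (v n)); apply/asboolP; exists v.
  case: (ex_minnP exP) => k /asboolP[v' [bv' av' sv']] kmin.
  exists v' => _; split=> // v'' bv'' av''; rewrite sv'; apply: kmin.
  by apply/asboolP; exists v''.
have [F HF] := choice minstep.
pose V := fix V n := if n is n'.+1 then F (n, V n') else F (0%N, u).
have badV n : bad (V n).
  elim: n => [|n IH] /=; first by case: (HF (0%N, u) bad_u).
  by case: (HF (n.+1, V n) IH).
have agV n i : (i <= n)%N -> V n i = V i i.
  elim: n => [|n IH]; first by rewrite leqn0 => /eqP->.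
  rewrite leq_eqVlt => /orP[/eqP->//|lein].
  have [_ ag _] := HF (n.+1, V n) (badV n).
  by rewrite /= ag //= IH.
pose d n := V n n.
have d_bad : bad d.
  split=> [n|i j ij]; first exact: (badV n).1.
  by rewrite /d -(agV j i (ltnW ij)); exact: (badV j).2.
have d_min n v' : bad v' -> agree n d v' -> (size (d n) <= size (v' n))%N.
  case: n => [|n] bv' av'.
    by have [_ _] := HF (0%N, u) bad_u; exact.
  have [_ _] := HF (n.+1, V n) (badV n); apply => // i /= lein.
  by rewrite av' // agV.
have dcons n : exists xs, d n = xs.1 :: xs.2.
  case E: (d n) => [|x s]; last by exists (x, s).
  by case: (d_bad.2 n n.+1 (ltnSn n)); rewrite E; constructor.
have [ht dE] := choice dcons.
have Ah n : A (ht n).1 by apply: (d_bad.1 n); rewrite dE mem_head.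
have [phi [phi_lt phiR]] :=
  @good_subsequence _ _ _ (fun n => (ht n).1) Rtr gR Ah.
(* From [phi 0] on, the terms give way to the tails of a subsequence with increasing heads: still
   bad, yet shorter at [phi 0]. *)
pose v n := if (n < phi 0)%N then d n else (ht (phi (n - phi 0)%N)).2.
have phi0 n : (phi 0 <= phi n)%N by case: n => // n; exact: ltnW (phi_lt _ _ _).
have v_bad : bad v.
  split=> [n x|i j ij].
    rewrite /v; case: ifP => _ xin; first exact: (d_bad.1 n).
    by apply: (d_bad.1 (phi (n - phi 0)%N)); rewrite dE inE xin orbT.
  rewrite /v; case: (ltnP j (phi 0%N)) => [jl|jg].
    by rewrite (ltn_trans ij jl); exact: d_bad.2.
  case: ltnP => [il|ig] e.
    apply: (d_bad.2 i (phi (j - phi 0)%N)); first exact: leq_trans il (phi0 _).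
    by rewrite (dE (phi _)); exact: seq_emb_skip.
  have lt : (i - phi 0 < j - phi 0)%N by lia.
  apply: (d_bad.2 _ _ (phi_lt _ _ lt)); rewrite !dE.
  by apply: seq_emb_cons => //; exact: phiR.
have := d_min (phi 0%N) v v_bad.
rewrite /v ltnn subnn dE /= ltnn => H; apply: notF; apply: H => i il.
by rewrite il.
Qed.

(** * Toeplitz words *)

(* Meaningful for n > 0 only, since logn 3 0 = 0. *)
Definition toeplitz (y : nat -> bool) (n : nat) : bool := y (logn 3 n).

Lemma ltn_log3 (n K : nat) : (0 < n < 3 ^ K)%N -> (logn 3 n < K)%N.
Proof.
move=> /andP[n0 nK]; rewrite ltnNge -pfactor_dvdn //.
by apply/negP => /(dvdn_leq n0); rewrite leqNgt nK.
Qed.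

Lemma eq_logn (p m n : nat) : prime p -> (0 < m)%N -> (0 < n)%N ->
  (forall e, (p ^ e %| m) = (p ^ e %| n)) -> logn p m = logn p n.
Proof.
move=> pp m0 n0 H; apply/eqP; rewrite eqn_leq -!pfactor_dvdn //.
by rewrite -H pfactor_dvdnn H pfactor_dvdnn.
Qed.

(** The valuation of [n] is below [K], so adding a multiple of [3 ^ K] leaves it unchanged. *)
Lemma toeplitz_period (y : nat -> bool) (K c n : nat) :
  (0 < n < 3 ^ K)%N -> toeplitz y (3 ^ K * c + n) = toeplitz y n.
Proof.
move=> nK; have lnK := ltn_log3 nK; case/andP: nK => n0 nK.
congr y; apply/eqP; rewrite eqn_leq; apply/andP; split; last first.
  rewrite -pfactor_dvdn //; last by lia.
  by rewrite dvdn_add ?pfactor_dvdnn // dvdn_mulr // dvdn_exp2l // ltnW.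
rewrite leqNgt -pfactor_dvdn //; last by lia.
apply/negP; rewrite dvdn_addr; last by rewrite dvdn_mulr // dvdn_exp2l.
by rewrite pfactor_dvdn // ltnn.
Qed.

(** Two positive numbers with sum [3 ^ K] are divisible by the same powers of 3. This handles
    components embedded backwards. *)
Lemma toeplitz_rev (y : nat -> bool) (K n : nat) :
  (0 < n < 3 ^ K)%N -> toeplitz y (3 ^ K - n) = toeplitz y n.
Proof.
move=> nK; have mK : (0 < 3 ^ K - n < 3 ^ K)%N by lia.
congr y; apply: eq_logn => //; try lia.
have half a b e : (0 < a < 3 ^ K)%N -> (a + b = 3 ^ K)%N -> 3 ^ e %| a -> 3 ^ e %| b.
  move=> aK abK ea; rewrite -(dvdn_addr _ ea) abK dvdn_exp2l //.
  apply: ltnW; apply: leq_trans (ltn_log3 aK).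
  by rewrite ltnS -pfactor_dvdn //; case/andP: aK.
move=> e; apply/idP/idP; apply: half => //; lia.
Qed.

Lemma multiple_in_window (d s : nat) : (0 < d)%N ->
  exists c, (s <= d * c <= s + d)%N.
Proof.
move=> d0; exists (s %/ d).+1; have := divn_eq s d; have := ltn_pmod s d0.
rewrite mulnS mulnC; lia.
Qed.

Lemma toeplitz_recurrent (y : nat -> bool) (K s : nat) :
  exists t, (s <= t <= s + 3 ^ K)%N /\
    forall n, (0 < n < 3 ^ K)%N -> toeplitz y (t + n) = toeplitz y n.
Proof.
have [//|c Hc] := @multiple_in_window (3 ^ K) s; first by rewrite expn_gt0.
by exists (3 ^ K * c)%N; split=> // n; exact: toeplitz_period.
Qed.

Lemma toeplitz_true_syndetic (y : nat -> bool) (k : nat) : y k ->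
  exists D, forall s, exists n, (s < n <= s + D)%N /\ toeplitz y n.
Proof.
move=> yk; exists (3 ^ k.+2)%N => s.
have [t [st Ht]] := toeplitz_recurrent y k.+1 s.
have lt : (0 < 3 ^ k < 3 ^ k.+1)%N by rewrite expn_gt0 ltn_exp2l /=.
exists (t + 3 ^ k)%N; split; first by rewrite !expnS in st lt *; lia.
by rewrite Ht // /toeplitz pfactorK.
Qed.

Definition occurs_in (y y' : nat -> bool) :=
  forall N, exists s, forall n, (0 < n <= N)%N ->
    toeplitz y n = toeplitz y' (s + n).

Lemma toeplitz_mul3 (y : nat -> bool) (n : nat) : (0 < n)%N ->
  toeplitz y (3 * n) = toeplitz (y \o succn) n.
Proof. by move=> n0; rewrite /toeplitz lognM // (@pfactorK 3 1). Qed.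

Lemma toeplitz_ndvd3 (y : nat -> bool) (n : nat) : ~~ (3 %| n) ->
  toeplitz y n = y 0%N.
Proof.
by move=> n3; rewrite /toeplitz lognE /=; case: ifP => // /andP[_ d]; rewrite d in n3.
Qed.

(* If the shift were not a multiple of 3, the multiples of 3, on which the
   first word takes all the values y 1, y 2, ..., would meet the constant
   part of the second word. *)
Lemma occurs_in_shift (y y' : nat -> bool) (k : nat) :
  y k != y 0%N -> occurs_in y y' ->
  y 0%N = y' 0%N /\ occurs_in (y \o succn) (y' \o succn).
Proof.
move=> yk occ.
have H N : exists s, forall n, (0 < n <= N)%N ->
    toeplitz y n = toeplitz y' (3 * s + n).
  have [s Hs] := occ (3 + N + 3 ^ k)%N.
  have [s3|s3] := boolP (3 %| s).
    exists (s %/ 3)%N => n nN; rewrite mulnC divnK // Hs //; lia.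
  (* As [k > 0], [3 ^ k] is a multiple of 3 and [s + 3 ^ k] is not. Likewise one of [s + 1], [s + 2]
     is not, which gives [y0']. *)
  have yk' : y k = y' 0%N.
    have := Hs (3 ^ k)%N; rewrite {1}/toeplitz pfactorK // => ->; last first.
      by rewrite expn_gt0 /=; lia.
    rewrite toeplitz_ndvd3 // dvdn_addl //.
    case: k yk {Hs} => [|k] yk; first by rewrite eqxx in yk.
    by rewrite expnS dvdn_mulr.
  have y0' : y 0%N = y' 0%N.
    have [d|d] := boolP (3 %| s + 1).
      have := Hs 2%N; rewrite !toeplitz_ndvd3 //; last by lia.
      by apply; lia.
    by have := Hs 1%N; rewrite !toeplitz_ndvd3 //; apply; lia.
  by rewrite yk' y0' eqxx in yk.
split.
  have [s Hs] := H 1%N.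
  by have := Hs 1%N; rewrite !toeplitz_ndvd3 //; [apply|lia].
move=> N; have [s Hs] := H (3 * N)%N; exists s => n nN.
by rewrite -toeplitz_mul3 ?Hs -?mulnDr ?toeplitz_mul3 //; lia.
Qed.

(** [occurs_in_shift] peels off one letter at a time; nonconstant tails let it apply at every
    level. *)
Lemma occurs_in_eq (y y' : nat -> bool) :
  (forall j, exists k, y (j + k)%N != y j) -> occurs_in y y' -> y =1 y'.
Proof.
move=> nc occ j; suff [] : y (j + 0)%N = y' (j + 0)%N /\
  occurs_in (fun k => y (j + k)%N) (fun k => y' (j + k)%N) by rewrite addn0.
have step i : occurs_in (fun k => y (i + k)%N) (fun k => y' (i + k)%N) ->
  y (i + 0)%N = y' (i + 0)%N /\
  occurs_in (fun k => y (i.+1 + k)%N) (fun k => y' (i.+1 + k)%N).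
  have [k yk] := nc i.
  move=> /(@occurs_in_shift _ _ k)[]; first by rewrite addn0.
  move=> -> occ'; split=> // N; have [s Hs] := occ' N; exists s => n nN.
  by have := Hs n nN; rewrite /toeplitz /= !addnS.
have all i : occurs_in (fun k => y (i + k)%N) (fun k => y' (i + k)%N).
  by elim: i => // i /step[].
by split; [exact: (step j (all j)).1|exact: all].
Qed.

(* The pairs x k, ~~ x k keep every tail nonconstant. *)
Definition alternating (x : nat -> bool) (j : nat) : bool := x j./2 (+) odd j.

Lemma alternating_neq (x : nat -> bool) (k : nat) :
  alternating x k.*2.+1 = ~~ alternating x k.*2.
Proof.
rewrite /alternating /= odd_double /= addbF addbT.
by rewrite uphalf_double doubleK.
Qed.

(** After an even [j] the next entry differs; after an odd [j] the next two entries are opposite, so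
    one of them differs. *)
Lemma alternating_nonconstant (x : nat -> bool) (j : nat) :
  exists k, alternating x (j + k) != alternating x j.
Proof.
rewrite -{1 2}(odd_double_half j); case: (odd j); last first.
  by exists 1%N; rewrite add0n addn1 alternating_neq; case: alternating.
have [|] := boolP (alternating x (1 + j./2.*2 + 1) == alternating x (1 + j./2.*2)).
  move=> /eqP E; exists 2%N; rewrite -E.
  rewrite (_ : 1 + _ + 2 = (j./2.+1).*2.+1)%N; last by lia.
  rewrite (_ : 1 + _ + 1 = (j./2.+1).*2)%N; last by lia.
  by rewrite alternating_neq; case: alternating.
by exists 1%N.
Qed.

Lemma alternating_true (x : nat -> bool) : exists k, alternating x k.
Proof.
case E: (alternating x 0%N); first by exists 0%N.
by exists 1%N; rewrite (alternating_neq x 0) E.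
Qed.

Lemma alternating_inj (x x' : nat -> bool) :
  alternating x =1 alternating x' -> x =1 x'.
Proof.
by move=> E k; have := E k.*2; rewrite /alternating doubleK odd_double !addbF.
Qed.

(** * Factors *)

(** The first letter is number [s.+1], which keeps the meaningless letter 0 out of every factor. *)
Definition window (y : nat -> bool) (s n : nat) : seq bool :=
  mkseq (fun k => toeplitz y (s + k).+1) n.

Definition toeplitz_factor (y : nat -> bool) (u : seq bool) :=
  exists s n, u = window y s n.

Lemma size_window (y : nat -> bool) (s n : nat) : size (window y s n) = n.
Proof. exact: size_mkseq. Qed.

(** Pigeonhole: padding with [None] up to length [B] codes the sequences in a finite type. *)
Lemma bounded_seq_repeats (T : finType) (u : nat -> seq T) (B : nat) :
  (forall n, size (u n) <= B)%N -> exists i j, (i < j)%N /\ u i = u j.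
Proof.
move=> uB; apply: contrapT => norep.
pose code (i : 'I_(#|{ffun 'I_B -> option T}|.+1)) : {ffun 'I_B -> option T} :=
  [ffun k : 'I_B => onth (u i) k].
suff /leq_card : injective code by rewrite card_ord ltnn.
have code_eq i j : code i = code j -> u i = u j.
  move=> /ffunP E; apply/eq_from_onth => k.
  have [kB|Bk] := ltnP k B; first by have := E (Ordinal kB); rewrite !ffunE.
  by rewrite !onth_default // (leq_trans (uB _)).
move=> i j /code_eq E; apply/val_inj => /=.
by case: (ltngtP i j) => // lt; case: norep; [exists i, j|exists j, i].
Qed.

Lemma window_infix (y : nat -> bool) (s n : nat) :
  exists L, forall s' n', (L <= n')%N -> infix (window y s n) (window y s' n').
Proof.
pose K := (s + n).+1.
have lK : (s + n < 3 ^ K)%N by apply: ltn_trans (ltn_expl _ _).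
(* One [3 ^ K] to reach a recurrence time [t], another to contain the copy that follows it. *)
exists (3 ^ K + 3 ^ K)%N => s' n' Ln'.
have [t [st Ht]] := toeplitz_recurrent y K s'.
pose a := (t - s' + s)%N.
have nE : n' = (a + (n + (n' - n - a)))%N by lia.
apply/infixP; exists (window y s' a), (window y (s' + a + n)%N (n' - n - a)%N).
rewrite nE /window /mkseq !iotaD !map_cat add0n -nE; congr (_ ++ (_ ++ _)).
  rewrite -[in iota a n](addn0 a) iotaDl -map_comp.
  apply/eq_in_map => k; rewrite mem_iota => kn /=.
  by rewrite (_ : (s' + (a + k)).+1 = t + (s + k).+1)%N ?Ht //; lia.
rewrite -[in LHS](addn0 (a + n)%N) iotaDl -map_comp.
by apply/eq_in_map => k _ /=; rewrite !addnA.
Qed.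

Definition subword (u v : seq bool) : Prop := infix u v.

(** Either a later factor is long enough to contain the first one, or the later ones have bounded
    length and two coincide. *)
Lemma good_factors (y : nat -> bool) : good subword (toeplitz_factor y).
Proof.
move=> u Fu; have [s [n u0]] := Fu 0%N; have [L HL] := window_infix y s n.
have [[j Lj]|short] := pselect (exists j, L <= size (u j.+1))%N.
  exists 0%N, j.+1; split=> //; have [s' [n' uj]] := Fu j.+1.
  by rewrite u0 uj; apply: HL; rewrite uj size_window in Lj.
have [|i [j [ij E]]] := @bounded_seq_repeats _ (fun n => u n.+1) L.
  by move=> k; rewrite leqNgt; apply/negP => /ltnW Lk; apply: short; exists k.
by exists i.+1, j.+1; split=> //; rewrite E; exact: infix_refl.
Qed.

(* A subset of a component is coded by the labels of its elements, None standing
   for a position outside the subset; it splits into its maximal runs. *)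
Definition unsplit_none (l : seq (seq bool)) : seq (option bool) :=
  foldr (fun u m => map Some u ++ None :: m) [::] l.

Lemma nth_map_some_cat (u : seq bool) (m : seq (option bool)) (p : nat) :
  nth None (map Some u ++ None :: m) p =
  if (p < size u)%N then Some (nth false u p)
  else if p == size u then None else nth None m (p - (size u).+1).
Proof.
rewrite nth_cat size_map; case: ltnP => [pu|up]; first exact: nth_map.
case: eqP => [->|/eqP pu]; first by rewrite subnn.
by rewrite (_ : p - size u = (p - (size u).+1).+1)%N //; lia.
Qed.

(** The added [None] closes the last run. The first run is kept apart, with its starting point,
    because the induction extends it by a letter. *)
Lemma split_none (y : nat -> bool) (m : seq (option bool)) (s : nat) :
  (forall p b, nth None m p = Some b -> b = toeplitz y (s + p).+1) ->
  exists n l, rcons m None = unsplit_none (window y s n :: l) /\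
    forall v, v \in l -> toeplitz_factor y v.
Proof.
elim: m s => [|x m IH] s H; first by exists 0%N, [::].
have [|n [l [E Hl]]] := IH s.+1.
  by move=> p b Hb; rewrite (H p.+1 b) // addSnnS.
case: x H => [b|] H.
  exists n.+1, l; split=> //; rewrite /= E /= addn0 (H 0%N b) // addn0.
  congr (_ :: (map Some _ ++ _)).
  rewrite /window /mkseq -[1%N](addn0 1) iotaDl -map_comp.
  by apply: eq_map => k /=; rewrite addSn add1n addnS.
exists 0%N, (window y s.+1 n :: l); split; first by rewrite /= E.
move=> v; rewrite inE => /orP[/eqP->|]; last exact: Hl.
by exists s.+1, n.
Qed.

(** On occupied positions, preserving and reflecting successors yields the same for adjacency within
    a component. *)
Definition mask_emb (m m' : seq (option bool)) (f : nat -> nat) :=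
  (forall p b, nth None m p = Some b -> nth None m' (f p) = Some b) /\
  (forall p q b c, nth None m p = Some b -> nth None m q = Some c ->
     (f p = f q -> p = q) /\ (f q = (f p).+1 <-> q = p.+1)).

(** Distinct runs go into distinct runs, and the [None] after each run keeps their images from
    becoming consecutive. *)
Lemma unsplit_none_emb (l l' : seq (seq bool)) :
  seq_emb subword l l' ->
  exists f, mask_emb (unsplit_none l) (unsplit_none l') f.
Proof.
elim=> {l l'} [t|u v l l' uv _ [f [f1 f2]]|v l l' _ [f [f1 f2]]].
- by exists id; split=> [p b|p q b c]; rewrite nth_nil.
- have [a [a' vE]] : exists a a' : seq bool, v = a ++ u ++ a' by exact/infixP.
  have sv : size v = (size a + (size u + size a'))%N by rewrite vE !size_cat.
  (* Within [u], shift to its place in [v]; past the separator after [u], apply [f] past the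
     separator after [v]. *)
  exists (fun p => if (p < size u)%N then (size a + p)%N
                   else ((size v).+1 + f (p - (size u).+1))%N).
  split=> [p b|p q b c].
    rewrite /= !nth_map_some_cat; case: ltnP => [pu <-|up].
      rewrite ifT; last by lia.
      by rewrite vE nth_cat ltnNge leq_addr /= addKn nth_cat pu.
    case: eqP => // pu Hp; rewrite ifF; last by lia.
    rewrite ifF; last by lia.
    by rewrite addKn; exact: f1.
  rewrite /= !nth_map_some_cat.
  case: (ltnP p (size u)) => pu; case: (ltnP q (size u)) => qu.
  + by move=> _ _; lia.
  + by case: eqP => // qu' _ _; lia.
  + by case: eqP => // pu' _ _; lia.
  + case: eqP => // pu'; case: eqP => // qu' Hp Hq.
    have [g1 g2] := f2 _ _ _ _ Hp Hq; split; first by lia.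
    split=> [E|E]; first by have := g2.1; lia.
    by have := g2.2; lia.
- exists (fun p => (size v).+1 + f p)%N; split=> [p b|p q b c].
    move=> /f1; rewrite /= nth_map_some_cat ifF; last by lia.
    by rewrite ifF ?addKn //; lia.
  move=> Hp Hq; have [g1 g2] := f2 _ _ _ _ Hp Hq; split; first by lia.
  by rewrite -g2; lia.
Qed.

(** * Embeddings and induced paths *)

Lemma inj_surj_bijective (X Y : Type) (f : X -> Y) :
  injective f -> (forall y, exists x, f x = y) -> bijective f.
Proof.
move=> fI /choice[g gK]; exists g => [x|y]; last exact: gK.
by apply: fI; rewrite gK.
Qed.

Lemma embedsP (H K : graph) : embeds H K <->
  exists f : H -> K, injective f /\ forall x y, adj x y <-> adj (f x) (f y).
Proof.
split=> [[A [f [fbij fadj]]]|[f [fI fadj]]].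
  exists (fun x => sval (f x)); split=> [x y E|x y]; last exact: fadj.
  by apply: (bij_inj fbij); apply: eq_sig_hprop => // z; exact: Prop_irrelevance.
exists (range f); exists (fun x => exist (range f) (f x) (ex_intro2 _ _ x I erefl)).
split=> //; apply: inj_surj_bijective => [x y /(congr1 sval)/= /fI//|[y [x xT xy]]].
by exists x; apply: eq_sig_hprop => // z; exact: Prop_irrelevance.
Qed.

Lemma embeds_trans (G H K : graph) : embeds G H -> embeds H K -> embeds G K.
Proof.
move=> /embedsP[f [fI fa]] /embedsP[g [gI ga]]; apply/embedsP.
exists (g \o f); split; first exact: inj_comp.
by move=> x y; rewrite fa ga.
Qed.

(** An infinite antichain maps onto [nat], and preimages of 0, 1, ... form a bad sequence. In a
    strictly descending sequence, [u i] embedding in a later [u j] would embed in [u i.+1]. *)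
Lemma good_wqo (F : set graph) : good embeds F -> wqo embeds F.
Proof.
move=> gF; split=> [B BF Banti|[u [Fu udesc]]].
  apply: contrapT => /infiniteP/pcard_surjP[g gB].
  have tot n : exists G, B G /\ g G = n.
    by have [G BG gG] := gB n I; exists G.
  have [u Hu] := choice tot.
  have [n|i [j [ij Rij]]] := gF u; first by apply: BF; exact: (Hu n).1.
  apply: Banti Rij; [exact: (Hu i).1|exact: (Hu j).1|].
  by move=> /(congr1 g); rewrite !(Hu _).2 => E; rewrite E ltnn in ij.
have [i [j [ij Rij]]] := gF u Fu.
have desc k : embeds (u (i.+1 + k)%N) (u i.+1).
  elim: k => [|k IH]; last by rewrite addnS; exact: embeds_trans (udesc _).1 IH.
  by rewrite addn0; apply/embedsP; exists id; split.
apply: (udesc i).2; apply: embeds_trans Rij _.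
by rewrite -(subnKC ij).
Qed.

Definition induced_path (G : graph) (m : nat) (g : nat -> G) :=
  forall a b, (a <= m)%N -> (b <= m)%N ->
    (g a = g b -> a = b) /\ (adj (g a) (g b) <-> (a = b.+1 \/ b = a.+1)).

Lemma interval_convex (I : interval int) (x y z : int) :
  x \in I -> y \in I -> (x <= z <= y)%R -> z \in I.
Proof.
by case: I => [[[] a|[]] [[] b|[]]]; rewrite !in_itv /=; lia.
Qed.

Lemma interval_run (I : interval int) (m : nat) :
  [set` I] #= `I_m.+1 -> exists c : int, forall k : nat, (k <= m)%N ->
    (c + k%:Z)%R \in I.
Proof.
move=> Im.
have count (c : int) k :
    (forall z, z \in I -> (c <= z < c + k%:Z)%R) -> (m < k)%N.
  move=> H; rewrite -card_le_II.
  have -> : (`I_m.+1 #<= `I_k) = ([set` I] #<= `I_k) by apply/esym/card_le_eql.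
  apply: card_le_trans (card_image_le (fun j : nat => (c + j%:Z)%R) `I_k).
  apply: subset_card_le => z /= /H zc.
  by exists (`|z - c|%N); rewrite /=; lia.
have [x0 x0I] : exists x0, x0 \in I.
  apply: contrapT => none; have := @count 0%R 0%N.
  by rewrite ltn0 => /(_ _)/notF[] // z zI; case: none; exists z.
(* If [x0 - m] is in [I], convexity gives the run ending at [x0]. Otherwise the descent from [x0]
   stops at the least element of [I], where the run starts. *)
have [x0m|x0m] := boolP ((x0 - m%:Z)%R \in I).
  exists (x0 - m%:Z)%R => k km; apply: interval_convex x0m x0I _; lia.
have exk : exists k : nat, (x0 - k%:Z)%R \notin I by exists m.
case: (ex_minnP exk) => [[|k] kN kmin].
  by rewrite GRing.subr0 x0I in kN.
pose c := (x0 - k%:Z)%R.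
have cI : c \in I by apply/negPn/negP => /kmin; rewrite ltnn.
have cmin z : z \in I -> (c <= z)%R.
  move=> zI; rewrite Order.TotalTheory.leNgt; apply/negP => zc; move/negP: kN; apply.
  apply: interval_convex zI cI _; rewrite /c in zc *; lia.
exists c => j jm; apply/negPn/negP => jN.
have : (m < j)%N.
  apply: (count c) => z zI; rewrite cmin //= Order.TotalTheory.ltNge.
  apply/negP => jz; move/negP: jN; apply.
  by apply: interval_convex cI zI _; lia.
lia.
Qed.

Lemma finite_path_induced_path (P : graph) (m : nat) :
  finite_path m P -> exists g : nat -> P, induced_path m g.
Proof.
move=> [[I [f [[ff fI fs] fadj]]] Pm].
have fI' : injective f by move=> x y; apply: fI; rewrite inE.
have [] := @interval_run I m.
  apply: card_eq_trans Pm; rewrite (_ : [set` I] = f @` [set: P]).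
    by apply: inj_card_eq => x y _ _; exact: fI'.
  by apply/seteqP; split=> // z [x xP <-]; exact: ff.
move=> c Hc.
have [p0 _ _] := fs _ (Hc 0%N (leq0n m)).
have tot k : exists p, (k <= m)%N -> f p = (c + k%:Z)%R.
  case: (leqP k m) => [/Hc/fs[p _ <-]|_]; first by exists p.
  by exists p0.
have [g Hg] := choice tot; exists g => a b am bm; split.
  by move=> /(congr1 f); rewrite !Hg //; lia.
by rewrite fadj !Hg //; lia.
Qed.

Lemma induced_path_finite_path (G : graph) (m : nat) (g : nat -> G) :
  induced_path m g -> finite_path m (induced (g @` `I_m.+1)).
Proof.
move=> gp; set P := induced _.
have tot (x : P) : exists k, (k <= m)%N /\ g k = sval x.
  by case: x => x [k /= km <-]; exists k.
have [idx Hidx] := choice tot.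
have idx_bij : set_bij [set: P] `I_m.+1 idx.
  split=> [x _|x y _ _ E|k km].
  - exact: (Hidx x).1.
  - apply: eq_sig_hprop; first by move=> z; exact: Prop_irrelevance.
    by rewrite -(Hidx x).2 -(Hidx y).2 E.
  - exists (exist _ (g k) (ex_intro2 _ _ k km erefl)) => //.
    have [im] := Hidx (exist _ (g k) (ex_intro2 _ _ k km erefl)).
    by move=> /= E; apply: (gp _ _ im km).1.
split; last by apply/card_set_bijP; exists idx.
exists `[0, m%:Z]%R, (Posz \o idx); split.
  case: idx_bij => i1 i2 i3; split=> [x xP|x y xP yP [] E|z].
  - by have := i1 x xP; rewrite /= in_itv /=; lia.
  - exact: i2.
  - rewrite /= in_itv /= => zm; case: (i3 `|z|%N) => [|x _ xE]; first by rewrite /=; lia.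
    by exists x => //=; rewrite xE; lia.
move=> u v; rewrite /= /induced_adj -(Hidx u).2 -(Hidx v).2.
rewrite (gp _ _ (Hidx u).1 (Hidx v).1).2.
by lia.
Qed.

(** * Path-minimality *)

(* The vertex (i, p) is the p-th one, counting from 0, of the i-th component; its
   label is the letter p.+1. *)
Definition pos_adj (y : nat -> bool) (v w : nat * nat) : Prop :=
  (v.1 = w.1 /\ (v.2 = w.2.+1 \/ w.2 = v.2.+1)) \/
  (v.1 <> w.1 /\ toeplitz y v.2.+1 /\ toeplitz y w.2.+1).

Lemma pos_adj_same (y : nat -> bool) (v w : nat * nat) : v.1 = w.1 ->
  pos_adj y v w <-> (v.2 = w.2.+1 \/ w.2 = v.2.+1).
Proof. by rewrite /pos_adj; tauto. Qed.

Lemma pos_adj_diff (y : nat -> bool) (v w : nat * nat) : v.1 <> w.1 ->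
  pos_adj y v w <-> (toeplitz y v.2.+1 /\ toeplitz y w.2.+1).
Proof. by rewrite /pos_adj; tauto. Qed.

Section SumGraph.
Variable y : nat -> bool.

Definition sum_adj (v w : {p : nat * nat | (p.2 < p.1)%N}) :=
  pos_adj y (val v) (val w).

Lemma sum_adj_sym v w : sum_adj v w -> sum_adj w v.
Proof.
case=> [[E1 E2]|[D [H1 H2]]]; first by left; split=> //; tauto.
by right; split=> // E; apply: D.
Qed.

Lemma sum_adj_irr v : ~ sum_adj v v.
Proof. by case=> [[_ ?]|[]//]; lia. Qed.

Definition path_sum : graph := Graph sum_adj_sym sum_adj_irr.

End SumGraph.

(** [induced_path] on bare pairs, free of the proofs that they are vertices. *)
Definition pos_path (y : nat -> bool) (m : nat) (g : nat -> nat * nat) :=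
  forall a b, (a <= m)%N -> (b <= m)%N ->
    (g a = g b -> a = b) /\ (pos_adj y (g a) (g b) <-> (a = b.+1 \/ b = a.+1)).

(** Successive positions differ by 1, and injectivity forbids turning back. *)
Lemma pos_path_linear (y : nat -> bool) (m : nat) (g : nat -> nat * nat) :
  pos_path y m g -> (forall a, (a <= m)%N -> (g a).1 = (g 0%N).1) ->
  exists s, (forall a, (a <= m)%N -> (g a).2 = s + a)%N \/
            (forall a, (a <= m)%N -> (g a).2 + a = s)%N.
Proof.
move=> gp gc; exists (g 0%N).2.
have step a : (a < m)%N -> (g a).2 = (g a.+1).2.+1 \/ (g a.+1).2 = (g a).2.+1.
  move=> am; have E : (g a).1 = (g a.+1).1 by rewrite !gc // ltnW.
  by apply/(pos_adj_same y E)/(gp _ _ (ltnW am) am).2; right.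
have ne a : (a.+1 < m)%N -> (g a).2 <> (g a.+2).2.
  move=> am E; have : g a = g a.+2.
    by rewrite (surjective_pairing (g a)) E gc -1?(gc a.+2) -?surjective_pairing //; lia.
  by move/(gp _ _ (ltnW (ltnW am)) am).1; lia.
case: m gp gc step ne => [|m] gp gc step ne.
  by left=> a; rewrite leqn0 => /eqP->; lia.
have [down|up] := step 0%N isT.
  have H a : (a <= m)%N -> (g a).2 = (g a.+1).2.+1.
    elim: a => // a IH am; have := IH (ltnW am).
    have := step a.+1 am; have := ne a am; lia.
  right; elim=> [|a IH] am; first by lia.
  by have := IH (ltnW am); have := H a am; lia.
have H a : (a <= m)%N -> (g a.+1).2 = (g a).2.+1.
  elim: a => // a IH am; have := IH (ltnW am).
  have := step a.+1 am; have := ne a am; lia.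
left; elim=> [|a IH] am; first by lia.
by have := IH (ltnW am); have := H a am; lia.
Qed.

Lemma pos_path_step (y : nat -> bool) (m : nat) (g : nat -> nat * nat) (a : nat) :
  pos_path y m g -> (a < m)%N -> (g a).1 <> (g a.+1).1 ->
  toeplitz y (g a).2.+1 /\ toeplitz y (g a.+1).2.+1.
Proof.
move=> gp am D; apply/(pos_adj_diff y D)/(gp _ _ (ltnW am) am).2; by right.
Qed.

(** A stretch of label-0 vertices cannot change component, so it runs along consecutive letters of
    the word, where 0-runs are bounded. *)
Lemma pos_path_true (y : nat -> bool) (k : nat) : y k ->
  exists D, forall m g s, pos_path y m g -> (s + D <= m)%N ->
    exists a, (s <= a <= s + D)%N /\ toeplitz y (g a).2.+1.
Proof.
move=> /toeplitz_true_syndetic[D HD]; exists D => m g s gp sm.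
apply: contrapT => none.
pose g' a := g (s + a)%N.
have zero a : (a <= D)%N -> ~ toeplitz y (g' a).2.+1.
  by move=> aD H; apply: none; exists (s + a)%N; split=> //; lia.
have gp' : pos_path y D g'.
  move=> a b aD bD; have := gp (s + a)%N (s + b)%N.
  move=> []; try lia; move=> H1 H2; split; first by move/H1; lia.
  by rewrite H2; lia.
move: g' gp' zero => g' gp' zero.
have gc a : (a <= D)%N -> (g' a).1 = (g' 0%N).1.
  elim: a => // a IH aD; rewrite -(IH (ltnW aD)); apply: contrapT => ne.
  have [|H _] := pos_path_step gp' aD; first by move=> E; apply: ne.
  exact: zero (ltnW aD) H.
have [t [up|down]] := pos_path_linear gp' gc.
  have [n [tn Hn]] := HD t; apply: (zero (n - t).-1); first by lia.
  rewrite up; last by lia.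
  by rewrite (_ : (t + (n - t).-1).+1 = n) //; lia.
have [n [tn Hn]] := HD (t - D)%N.
have tD : (D <= t)%N by have := down D (leqnn D); lia.
apply: (zero (t.+1 - n)%N); first by lia.
rewrite (_ : (g' (t.+1 - n)%N).2.+1 = n) //.
by have := down (t.+1 - n)%N; lia.
Qed.

(* Label-1 vertices at distance at least 2 on an induced path must share a
   component, and two of them lying far apart control all the others. *)
Lemma long_path_component (y : nat -> bool) (k : nat) : y k ->
  exists M, forall m g, (M <= m)%N -> pos_path y m g ->
    forall a, (a <= m)%N -> (g a).1 = (g 0%N).1.
Proof.
move=> /pos_path_true[D HD]; exists (D + D + 3)%N => m g Mm gp.
have far a b : (a <= m)%N -> (b <= m)%N -> toeplitz y (g a).2.+1 ->
    toeplitz y (g b).2.+1 -> a <> b.+1 -> b <> a.+1 -> (g a).1 = (g b).1.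
  move=> am bm ta tb ab ba; apply: contrapT => ne.
  have /(gp _ _ am bm).2 : pos_adj y (g a) (g b) by right.
  by lia.
(* [e0] and [e1] are at least 3 apart, so every index is at distance at least 2 from one of them. *)
have [|e0 [r0 t0]] := HD m g 0%N gp; first by lia.
have [|e1 [r1 t1]] := HD m g (D + 3)%N gp; first by lia.
have e01 : (g e0).1 = (g e1).1 by apply: far => //; lia.
have ones a : (a <= m)%N -> toeplitz y (g a).2.+1 -> (g a).1 = (g e0).1.
  move=> am ta; have [lt|ge] := ltnP e0.+1 a; first by apply: far => //; lia.
  by rewrite e01; apply: far => //; lia.
elim=> // a IH am; rewrite -(IH (ltnW am)); apply: contrapT => ne.
have [|ta tb] := pos_path_step gp am; first by move=> E; apply: ne.
by apply: ne; rewrite !ones // ltnW.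
Qed.

Lemma induced_path_pos (y : nat -> bool) (m : nat) (g : nat -> path_sum y) :
  induced_path m g -> pos_path y m (fun a => val (g a)).
Proof.
move=> gp a b am bm; have [H1 H2] := gp a b am bm; split; last exact: H2.
by move=> /val_inj.
Qed.

Lemma path_sum_unbounded (y : nat -> bool) : unbounded_paths (path_sum y).
Proof.
move=> n.
(* Truncating at [n] makes the enumeration of component [n.+1] total. *)
have lt a : (minn a n < n.+1)%N by lia.
pose g a : path_sum y := exist _ (n.+1, minn a n) (lt a).
exists n, (g @` `I_n.+1); split=> //; apply: induced_path_finite_path.
move=> a b an bn; split; first by move=> [] /=; lia.
by rewrite /= /sum_adj pos_adj_same //=; lia.
Qed.

Lemma path_sum_minimal (y : nat -> bool) (k : nat) (A : set (path_sum y)) :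
  y k -> unbounded_paths (induced A) -> embeds (path_sum y) (induced A).
Proof.
move=> yk unb; have [M HM] := long_path_component yk.
(* A component of index above [B] in which [A] contains a labelled copy of the first [n] vertices,
   starting at position [io.2]. *)
have room (nB : nat * nat) : exists io : nat * nat, (nB.2 < io.1)%N /\
    forall p, (p < nB.1)%N -> toeplitz y (io.2 + p).+1 = toeplitz y p.+1 /\
      exists v : path_sum y, val v = (io.1, io.2 + p)%N /\ A v.
  case: nB => n B /=.
  pose K := n.+1; have nK : (n < 3 ^ K)%N by apply: ltn_trans (ltn_expl _ _).
  (* [M] confines the path to one component, [B] pushes the index of that component above [B], and
     the powers of 3 leave room for a recurrence time and the copy. *)
  have [m [C [Mm /finite_path_induced_path[g gp]]]] := unb (M + B + 3 ^ K + 3 ^ K)%N.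
  pose h a := val (sval (sval (g a))).
  have hp : pos_path y m h.
    apply: (induced_path_pos (g := fun a => sval (sval (g a)))) => a b am bm.
    have [H1 H2] := gp a b am bm; split; last exact: H2.
    by move=> E; apply: H1; do 2!(apply: eq_sig_hprop => [z|]; first exact: Prop_irrelevance).
  have hc := HM m h ltac:(lia) hp.
  have hin a : (a <= m)%N -> exists v : path_sum y, val v = ((h 0%N).1, (h a).2) /\ A v.
    move=> am; exists (sval (sval (g a))); split; last exact: (svalP (sval (g a))).
    by rewrite -(hc a am) -surjective_pairing.
  have [s Hs] : exists s, forall p, (s <= p <= s + m)%N ->
      exists v : path_sum y, val v = ((h 0%N).1, p) /\ A v.
    have [s [up|down]] := pos_path_linear hp hc.
      exists s => p sp; have /hin : (p - s <= m)%N by lia.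
      by rewrite up ?subnKC //; lia.
    exists (s - m)%N => p sp; have /hin : (s - p <= m)%N.
      by have := down m (leqnn m); lia.
    have -> // : (h (s - p)%N).2 = p.
    by have := down m (leqnn m); have := down (s - p)%N; lia.
  have [t [st Ht]] := toeplitz_recurrent y K s.
  exists ((h 0%N).1, t); split=> /=.
    have [v [vE _]] := Hs (s + m)%N ltac:(lia).
    by have := valP v; rewrite vE /=; lia.
  move=> p pn; split; first by rewrite -addnS Ht //; lia.
  by apply: Hs; lia.
have [F HF] := choice room.
(* Bounding below by the previous index sends distinct components to distinct components. *)
pose io := fix io n := if n is n'.+1 then F (n, (io n').1) else F (0%N, 0%N).
have io_lt i j : (i < j)%N -> ((io i).1 < (io j).1)%N.
  move: i j; apply: (homo_ltn (f := fun i => (io i).1) ltn_trans) => i.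
  exact: (HF (_, _)).1.
have io_in n p : (p < n)%N -> toeplitz y ((io n).2 + p).+1 = toeplitz y p.+1 /\
    exists v : path_sum y, val v = ((io n).1, (io n).2 + p)%N /\ A v.
  by case: n => [//|n] pn; exact: (HF (n.+1, (io n).1)).2.
have tot (v : path_sum y) : exists v' : induced A,
    val (sval v') = ((io (val v).1).1, (io (val v).1).2 + (val v).2)%N.
  by have [_ [v' [v'E Av']]] := io_in _ _ (valP v); exists (exist _ v' Av').
have [f Hf] := choice tot.
have io_inj i j : (io i).1 = (io j).1 -> i = j.
  by move=> E; case: (ltngtP i j) => // /io_lt; rewrite E ltnn.
apply/embedsP; exists f; split=> [v w E|v w].
  have := Hf v; rewrite E Hf => -[/io_inj E1]; rewrite E1 => /addnI E2.
  by apply/val_inj; rewrite (surjective_pairing (val v)) -E1 -E2 -surjective_pairing.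
rewrite /= /induced_adj /= /sum_adj !Hf.
have [E|D] := pselect ((val v).1 = (val w).1).
  rewrite !pos_adj_same //=; last by rewrite E.
  by rewrite E /=; lia.
rewrite !pos_adj_diff //; last by move/io_inj.
by rewrite (io_in _ _ (valP v)).1 (io_in _ _ (valP w)).1.
Qed.

(** * Ages *)

Definition encodes (y : nat -> bool) (H : graph) (L : seq (seq (seq bool))) :=
  exists f : H -> nat * nat,
    [/\ injective f, forall x x', adj x x' <-> pos_adj y (f x) (f x'),
        forall x, ((f x).1 < size L)%N &
        forall i p b, (i < size L)%N ->
          nth None (unsplit_none (nth [::] L i)) p = Some b <->
          b = toeplitz y p.+1 /\ exists x, f x = (i, p)].

Lemma finite_bounded (T : Type) (f : T -> nat) :
  finite_set [set: T] -> exists N, forall x, (f x < N)%N.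
Proof.
move=> /(finite_image f)/finite_seqP[s sE].
exists (\max_(i <- s) i).+1 => x; rewrite ltnS.
have : [set` s] (f x) by rewrite -sE; exists x.
by move=> /= xs; rewrite (big_rem _ xs) leq_maxl.
Qed.

Lemma age_encodes (y : nat -> bool) (H : graph) : age (path_sum y) H ->
  exists L, encodes y H L /\ forall l, l \in L -> forall u, u \in l -> toeplitz_factor y u.
Proof.
move=> [Hfin /embedsP[h [hI hadj]]].
pose f x := val (h x).
have [N HN] := finite_bounded (fun x => (f x).1) Hfin.
pose mask i := mkseq (fun p => if `[< exists x, f x = (i, p) >]
  then Some (toeplitz y p.+1) else None) i.
have maskE i p b : nth None (mask i) p = Some b <->
    b = toeplitz y p.+1 /\ exists x, f x = (i, p).
  have [pi|ip] := ltnP p i.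
    rewrite nth_mkseq //; case: asboolP => [ex|nex].
      by split=> [[<-]|[->]].
    by split=> // -[].
  rewrite nth_default ?size_mkseq //; split=> // -[_ [x xE]].
  by have := valP (h x); rewrite -/(f x) xE /= ltnNge ip.
have tot i : exists l, unsplit_none l = rcons (mask i) None /\
    forall u, u \in l -> toeplitz_factor y u.
  have [|n [l [E Hl]]] := @split_none y (mask i) 0%N.
    by move=> p b /maskE[->].
  exists (window y 0 n :: l); split=> // u; rewrite inE => /orP[/eqP->|/Hl//].
  by exists 0%N, n.
have [l Hl] := choice tot.
exists (mkseq l N); split; last first.
  by move=> l' /mapP[i _ ->]; exact: (Hl i).2.
exists f; split=> [x x' /val_inj/hI//|x x'|x|i p b].
- exact: hadj.
- by rewrite size_mkseq.
rewrite size_mkseq => iN; rewrite nth_mkseq // (Hl i).1 -maskE.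
(* The closing [None] coincides with the default value of [nth]. *)
rewrite nth_rcons; case: ltnP => // ip.
by rewrite nth_default //; case: ifP.
Qed.

(** Component [i] goes to component [phi i] by the map [F i]: [mask_emb] takes care of edges inside
    components, and equal labels of edges across them. *)
Lemma encodes_embeds (y : nat -> bool) (H H' : graph) L L' :
  encodes y H L -> encodes y H' L' ->
  seq_emb (seq_emb subword) L L' -> embeds H H'.
Proof.
move=> [f [fI fadj fL fE]] [f' [fI' fadj' fL' fE']].
move=> /(seq_emb_index [::])[phi [phi_lt phiE]].
have tot i : exists F, (i < size L)%N ->
    mask_emb (unsplit_none (nth [::] L i)) (unsplit_none (nth [::] L' (phi i))) F.
  have [iL|_] := ltnP i (size L); last by exists id.
  by have [F HF] := unsplit_none_emb (phiE i iL).2; exists F.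
have [F HF] := choice tot.
have nthE x : nth None (unsplit_none (nth [::] L (f x).1)) (f x).2 =
    Some (toeplitz y (f x).2.+1).
  by apply/fE => //; split=> //; exists x; exact: surjective_pairing.
have phi_inj i j : phi i = phi j -> i = j.
  by move=> E; case: (ltngtP i j) => // /phi_lt; rewrite E ltnn.
have toth x : exists x', f' x' = (phi (f x).1, F (f x).1 (f x).2) /\
    toeplitz y (F (f x).1 (f x).2).+1 = toeplitz y (f x).2.+1.
  have := (HF _ (fL x)).1 _ _ (nthE x).
  by move=> /fE'[|-> [x' x'E]]; [exact: (phiE _ (fL x)).1|exists x'].
have [h Hh] := choice toth.
apply/embedsP; exists h; split=> [x x' E|x x'].
  have := (Hh x).1; rewrite E (Hh x').1 => -[/phi_inj E1]; rewrite -E1 => E2.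
  have N1 := nthE x; rewrite -E1 in N1.
  have := ((HF _ (fL x')).2 _ _ _ _ (nthE x') N1).1 E2 => E3.
  by apply: fI; rewrite (surjective_pairing (f x)) -E1 -E3 -surjective_pairing.
rewrite fadj fadj' (Hh x).1 (Hh x').1.
have [E|D] := pselect ((f x).1 = (f x').1).
  rewrite !pos_adj_same //=; last by rewrite E.
  have N1 := nthE x; rewrite E in N1 *.
  have [_ <-] := (HF _ (fL x')).2 _ _ _ _ (nthE x') N1.
  by have [_ <-] := (HF _ (fL x')).2 _ _ _ _ N1 (nthE x').
rewrite !pos_adj_diff //=; last by move/phi_inj.
by rewrite (Hh x).2 (Hh x').2.
Qed.

Lemma age_path_sum_wqo (y : nat -> bool) : wqo embeds (age (path_sum y)).
Proof.
apply: good_wqo => u /(_ _)/age_encodes Hu.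
have [L HL] := choice Hu.
have sub_tr : forall u v w, subword u v -> subword v w -> subword u w.
  by move=> a b c; exact: infix_trans.
have [n l|i [j [ij Eij]]] := higman (seq_emb_trans sub_tr)
  (higman sub_tr (@good_factors y)) (u := L).
  exact: (HL n).2.
exists i, j; split=> //.
exact: encodes_embeds (HL i).1 (HL j).1 Eij.
Qed.

Lemma age_sub_occurs_in (y y' : nat -> bool) (k k' : nat) : y k -> y' k' ->
  age (path_sum y) `<=` age (path_sum y') -> occurs_in y y'.
Proof.
move=> yk yk' sub N; have [M HM] := long_path_component yk'.
(* [N] for the prefix sought, [2 * 3 ^ k] to reach two letters 1, [M] to keep each image path in one
   component. The test paths lie in components [N1.+1] and [N1.+2]. *)
pose N1 := (N + 2 * 3 ^ k + M)%N.
pose A : set (path_sum y) := [set v | ((val v).1 <= N1.+2)%N].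
have lt (b : bool) a : (minn a N1 < N1.+1 + b)%N by lia.
pose V (b : bool) (a : nat) : path_sum y := exist _ ((N1.+1 + b)%N, minn a N1) (lt b a).
have AV b a : A (V b a) by rewrite /A /=; lia.
have : age (path_sum y) (induced A).
  split; last first.
    apply/embedsP; exists sval; split=> // x x' E.
    by apply: eq_sig_hprop => // z; exact: Prop_irrelevance.
  pose S := (`I_N1.+3 `*` `I_N1.+3).
  pose f (x : induced A) := val (sval x).
  have Sfin : finite_set S by apply: finite_setX; exact: finite_II.
  apply: card_le_finite Sfin.
  have -> : [set: induced A] = f @^-1` S.
    apply/seteqP; split=> // x _.
    have p1 := valP (sval x); have p2 : ((val (sval x)).1 <= N1.+2)%N := svalP x.
    by split; rewrite /f /= in p1 p2 *; lia.
  apply: card_ge_preimage => x x' _ _ /val_inj E.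
  by apply: eq_sig_hprop => // z; exact: Prop_irrelevance.
move=> /sub[_ /embedsP[h [hI hadj]]].
pose g b a := val (h (exist A (V b a) (AV b a))).
have gI (b b' : bool) a a' : (a <= N1)%N -> (a' <= N1)%N -> g b a = g b' a' -> a = a'.
  by move=> am am' /val_inj/hI[_]; rewrite /= !(minn_idPl _).
have gadj (b b' : bool) a a' : (a <= N1)%N -> (a' <= N1)%N ->
    pos_adj y' (g b a) (g b' a') <-> pos_adj y ((N1.+1 + b)%N, a) ((N1.+1 + b')%N, a').
  move=> am am'; rewrite -[X in X <-> _]hadj /= /induced_adj /= /sum_adj /=.
  by rewrite !(minn_idPl _).
have gp b : pos_path y' N1 (g b).
  move=> a a' am am'; split; first exact: gI.
  by rewrite gadj // pos_adj_same.
have gc b a : (a <= N1)%N -> (g b a).1 = (g b 0%N).1.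
  by apply: (HM N1) => //; rewrite /N1; lia.
(* The letters [3 ^ k] and [2 * 3 ^ k] both equal [y k]; positions count from 0. *)
pose e0 := (3 ^ k).-1; pose e1 := (2 * 3 ^ k).-1.
have k0 : (0 < 3 ^ k)%N by rewrite expn_gt0.
have e0N : (e0 <= N1)%N by rewrite /e0 /N1; lia.
have e1N : (e1 <= N1)%N by rewrite /e1 /N1; lia.
have t0 : toeplitz y e0.+1 by rewrite /e0 prednK // /toeplitz pfactorK.
have t1 : toeplitz y e1.+1.
  by rewrite /e1 prednK ?muln_gt0 // /toeplitz lognM // pfactorK.
have cross a a' : (a <= N1)%N -> (a' <= N1)%N ->
    pos_adj y' (g false a) (g true a') <-> toeplitz y a.+1 /\ toeplitz y a'.+1.
  by move=> am am'; rewrite gadj // pos_adj_diff //=; lia.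
(* In a common component, the vertices [e0], [e1] of both copies would form a 4-cycle inside a
   path. *)
have diff : (g false 0%N).1 <> (g true 0%N).1.
  move=> E.
  have same a a' : (a <= N1)%N -> (a' <= N1)%N -> (g false a).1 = (g true a').1.
    by move=> am am'; rewrite !gc.
  have adj1 a a' (am : (a <= N1)%N) (am' : (a' <= N1)%N) :
      toeplitz y a.+1 -> toeplitz y a'.+1 ->
      (g false a).2 = (g true a').2.+1 \/ (g true a').2 = (g false a).2.+1.
    by move=> ta ta'; apply/(pos_adj_same y' (same _ _ am am'))/cross.
  have ne b : (g b e0).2 <> (g b e1).2.
    move=> E2; have : e0 = e1.
      apply: (gI b b) => //.
      by rewrite (surjective_pairing (g b e0)) E2 gc // -(gc b e1) // -surjective_pairing.
    by rewrite /e0 /e1; lia.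
  have := adj1 _ _ e0N e0N t0 t0; have := adj1 _ _ e0N e1N t0 t1.
  have := adj1 _ _ e1N e0N t1 t0; have := adj1 _ _ e1N e1N t1 t1.
  by have := ne true; have := ne false; lia.
(* The label of [a] is read off from adjacency to the vertex [e0] of the other copy, which has label
   1 on both sides. *)
have lab a : (a <= N1)%N -> toeplitz y a.+1 = toeplitz y' (g false a).2.+1.
  have diff' a' a'' : (a' <= N1)%N -> (a'' <= N1)%N ->
    (g false a').1 <> (g true a'').1 by move=> ? ?; rewrite !gc.
  move=> am; have [_ te] : toeplitz y' (g false e0).2.+1 /\
      toeplitz y' (g true e0).2.+1.
    by apply/(pos_adj_diff y' (diff' _ _ e0N e0N))/cross.
  apply/idP/idP => ta.
    by case/(cross _ _ am e0N)/(pos_adj_diff y' (diff' _ _ am e0N)): (conj ta t0).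
  by case/(pos_adj_diff y' (diff' _ _ am e0N))/(cross _ _ am e0N): (conj ta te).
have [s [up|down]] := pos_path_linear (gp false) (gc false).
  exists s => n nN; have nN1 : (n.-1 <= N1)%N by rewrite /N1; lia.
  by have := lab _ nN1; rewrite up // -addnS prednK //; lia.
have sN : (N1 <= s)%N by have := down N1 (leqnn _); lia.
(* The copy runs backwards; reflection in [3 ^ K] turns its letter [s.+2 - n] into letter
   [3 ^ K - s.+2 + n]. *)
pose K := s.+2; have sK : (s.+2 < 3 ^ K)%N by apply: ltn_expl.
exists (3 ^ K - s.+2)%N => n nN.
have nN1 : (n.-1 <= N1)%N by rewrite /N1; lia.
have := lab _ nN1; rewrite prednK; last by lia.
move=> ->; rewrite -(@toeplitz_rev _ K); last by have := down _ nN1; lia.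
by congr toeplitz; have := down _ nN1; lia.
Qed.

Theorem theorem1 :
  exists F : set graph,
    F #= [set: set nat] /\
    (forall G : graph, F G -> path_minimal G /\ wqo embeds (age G)) /\
    (forall G H : graph, F G -> F H -> G <> H ->
      ~ (age G `<=` age H) /\ ~ (age H `<=` age G)).
Proof.
pose code (X : set nat) := alternating (fun n => `[< X n >]).
pose G X := path_sum (code X).
(* This yields both the injectivity of [G], hence the cardinality, and incomparability in both
   directions. *)
have incomp X X' : age (G X) `<=` age (G X') -> X = X'.
  have [k yk] := alternating_true (fun n => `[< X n >]).
  have [k' yk'] := alternating_true (fun n => `[< X' n >]).
  move=> /(age_sub_occurs_in yk yk')/occurs_in_eq.
  move=> /(_ (alternating_nonconstant _))/alternating_inj E.
  apply/funext => n; have {}E : `[< X n >] = `[< X' n >] := E n.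
  by apply/propext; split=> /asboolP; [rewrite E|rewrite -E] => /asboolP.
exists (range G); split; last split.
- by apply: inj_card_eq => X X' _ _ E; apply: incomp; rewrite E.
- move=> _ [X _ <-]; split; last exact: age_path_sum_wqo.
  have [k yk] := alternating_true (fun n => `[< X n >]).
  split; first exact: path_sum_unbounded.
  by move=> A; exact: path_sum_minimal yk.
- by move=> _ _ [X _ <-] [X' _ <-] ne; split=> /incomp E; apply: ne; rewrite E.
Qed.
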